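(* Let $(\mathcal{V},\mathcal{E})$ be a finite graph with $n$ vertices, $h_i\in\mathbb{R}$ ($i\in\mathcal{V}$), $J_{ij}=J_{ji}\in\mathbb{R}$ for $(i,j)\in\mathcal{E}$ (and $J_{ij}=0$ for non-edges), and consider the Ising model $$\pi(x_1,\dots,x_n)\propto\exp\left(-\sum_{i\in\mathcal{V}}h_ix_i-\sum_{(i,j)\in\mathcal{E}}J_{ij}x_ix_j\right),\qquad x\in\{\pm1\}^n.$$ Let $R\in\mathbb{R}^{n\times n}$ have entries $R_{ij}=|J_{ij}|$ for $i\ne j$ and $R_{ii}=0$, with lower and upper triangular parts $R_L,R_U$. If $\rho(R)<1$, then the sequential, random-scan and parallel CAVI algorithms for $\pi$ (with one block per vertex) converge globally, i.e. from any initialisation, exponentially fast in total variation distance to the fixed point $\mu_\star=\mu_\star^1\otimes\dots\otimes\mu_\star^n$ of the CAVI updates, with rates $\rho((I_n-R_L)^{-1}R_U)$ (sequential), $\rho(\frac1nR+\frac{n-1}nI_n)$ (random scan, in expectation) and $\rho(R)$ (parallel). That is, for all $k\ge0$: $T_{k+1}\preceq(I_n-R_L)^{-1}R_UT_k$ (sequential), $\mathbb{E}[T_{k+1}\mid\mu_k]\preceq(\frac1nR+\frac{n-1}nI_n)T_k$ (random scan), $T_{k+1}\preceq RT_k$ (parallel).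
   Context: Edges are unordered pairs $i\ne j$, each counted once in the sum; $\partial i$ is the set of neighbours of $i$. The CAVI update of coordinate $i$ given the other factors $\nu^{-i}=(\nu^j)_{j\ne i}$ is $\mu_\star^i[\nu^{-i}](x_i)\propto\exp\left(-h_ix_i-\sum_{j\in\partial i}\mathbb{E}_{\nu^j}[J_{ij}x_iX_j]\right)$ on $\{\pm1\}$. Sequential: $\mu_{k+1}^i=\mu_\star^i[\mu_{k+1}^{<i},\mu_k^{>i}]$ for $i=1,\dots,n$ in order; parallel: $\mu_{k+1}^i=\mu_\star^i[\mu_k^{-i}]$ for all $i$; random scan: draw $I$ uniformly on $\{1,\dots,n\}$ (independently across iterations), set $\mu_{k+1}^I=\mu_\star^I[\mu_k^{-I}]$ and leave the other coordinates unchanged. A fixed point satisfies $\mu_\star^i=\mu_\star^i[\mu_\star^{-i}]$ for all $i$. $\mathsf{TV}(\varrho,\gamma)=\frac12\sum_x|\varrho(x)-\gamma(x)|$, $T_k=(\mathsf{TV}(\mu_k^1,\mu_\star^1),\dots,\mathsf{TV}(\mu_k^n,\mu_\star^n))^\top$; $\preceq$ is entrywise; $\rho(\cdot)$ is the spectral radius. *)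

(* Defs.v *)
From HB Require Import structures.
From mathcomp Require Import all_boot all_order all_algebra.
From mathcomp Require Import complex.
From mathcomp Require Import all_classical all_reals all_analysis.
From mathcomp Require Import ring.

Set Implicit Arguments.
Unset Strict Implicit.
Unset Printing Implicit Defensive.

Import Order.TTheory GRing.Theory Num.Theory.

Local Open Scope classical_set_scope.
Local Open Scope ring_scope.

Definition is_pmf (R : realType) (T : finType) (p : {ffun T -> R}) : Prop :=
  (forall x, 0 <= p x) /\ \sum_x p x = 1.

Definition tv (R : realType) (T : finType) (p q : {ffun T -> R}) : R :=
  2^-1 * \sum_x `|p x - q x|.

(* The spin space {+1, -1} is encoded by bool: true is +1 and false is -1. *)
Definition spin (R : realType) (b : bool) : R := if b then 1 else -1.

Definition config (n : nat) := {ffun 'I_n -> bool}.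

(* The marginals (nu^1, ..., nu^n) of a product distribution on spins. *)
Definition factors (R : realType) (n : nat) := {ffun 'I_n -> {ffun bool -> R}}.

Definition are_pmfs (R : realType) (n : nat) (nu : factors R n) : Prop :=
  forall i, is_pmf (nu i).

Definition product_law (R : realType) (n : nat) (nu : factors R n) :
    {ffun config n -> R} :=
  [ffun x : config n => \prod_i nu i (x i)].

Section Ising.
Variables (R : realType) (n : nat) (e : rel 'I_n) (h : 'I_n -> R) (J : 'M[R]_n).

(* Every undirected edge occurs once, as the ordered pair (i, j) with i < j. *)
Definition ising_weight (x : config n) : R :=
  expR (- (\sum_i h i * spin R (x i))
        - \sum_(i < n) \sum_(j < n | (i < j)%N && e i j)
            J i j * spin R (x i) * spin R (x j)).

Definition ising : {ffun config n -> R} :=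
  [ffun x => ising_weight x / \sum_y ising_weight y].

Definition cavi_weight (i : 'I_n) (nu : factors R n) (x : bool) : R :=
  expR (- (h i * spin R x)
        - \sum_(j | e i j) \sum_y nu j y * (J i j * spin R x * spin R y)).

(* The factor nu i is ignored as soon as e is irreflexive, so this is a
   function of nu^{-i} only. *)
Definition cavi_update (i : 'I_n) (nu : factors R n) : {ffun bool -> R} :=
  [ffun x => cavi_weight i nu x / \sum_y cavi_weight i nu y].

Definition cavi_fixed_point (nu : factors R n) : Prop :=
  forall i, nu i = cavi_update i nu.

Definition sequential_cavi (mu : nat -> factors R n) : Prop :=
  forall k i, mu k.+1 i =
    cavi_update i [ffun j : 'I_n => if (j < i)%N then mu k.+1 j else mu k j].

Definition parallel_cavi (mu : nat -> factors R n) : Prop :=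
  forall k i, mu k.+1 i = cavi_update i (mu k).

(* The random iterates driven by the random coordinates I 0, I 1, ... and
   started from the deterministic mu0. *)
Definition random_scan_cavi (Omega : Type) (I : nat -> Omega -> 'I_n)
    (mu0 : factors R n) (mu : nat -> Omega -> factors R n) : Prop :=
  (forall w, mu 0%N w = mu0) /\
  (forall k w i, mu k.+1 w i =
     if i == I k w then cavi_update i (mu k w) else mu k w i).

Definition set_factor (i : 'I_n) (p : {ffun bool -> R}) (nu : factors R n) :
    factors R n :=
  [ffun j => if j == i then p else nu j].

Definition point_mass (x : bool) : {ffun bool -> R} := [ffun y => (y == x)%:R].

(* E[log ising(X)] for X drawn from nu with its i-th coordinate set to x. *)
Definition mean_log_ising (i : 'I_n) (nu : factors R n) (x : bool) : R :=
  \sum_z product_law (set_factor i (point_mass x) nu) z * ln (ising z).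

Let mean (nu : factors R n) i : R := \sum_y nu i y * spin R y.

Lemma product_law_prod (nu : factors R n) (g : 'I_n -> bool -> R) :
  \sum_z product_law nu z * \prod_i g i (z i) =
  \prod_i \sum_y nu i y * g i y.
Proof.
rewrite (bigA_distr_bigA (fun i y => nu i y * g i y)).
by apply: eq_bigr => z _; rewrite ffunE big_split.
Qed.

Lemma product_law_sum1 (nu : factors R n) : are_pmfs nu ->
  \sum_z product_law nu z = 1.
Proof.
move=> nuP; rewrite (eq_bigr (fun z => product_law nu z * \prod_(i < n) 1)); last first.
  by move=> z _; rewrite big1_eq mulr1.
rewrite (product_law_prod nu (fun _ _ => 1)) big1// => i _.
by under eq_bigr do rewrite mulr1; case: (nuP i).
Qed.

Lemma product_law_spin (nu : factors R n) i : are_pmfs nu ->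
  \sum_z product_law nu z * spin R (z i) = mean nu i.
Proof.
move=> nuP.
pose g j y := if j == i then spin R y else 1.
rewrite (eq_bigr (fun z => product_law nu z * \prod_j g j (z j))); last first.
  by move=> z _; rewrite -big_mkcond big_pred1_eq.
rewrite product_law_prod /g (bigD1 i)//= eqxx [X in _ * X]big1 ?mulr1//.
move=> j /negPf ji; rewrite -[RHS](nuP j).2.
by apply: eq_bigr => y _; rewrite ji/= mulr1.
Qed.

Lemma product_law_spin2 (nu : factors R n) i j : are_pmfs nu -> i != j ->
  \sum_z product_law nu z * (spin R (z i) * spin R (z j)) =
  mean nu i * mean nu j.
Proof.
move=> nuP ij.
pose g k y := (if k == i then spin R y else 1) * (if k == j then spin R y else 1).
rewrite (eq_bigr (fun z => product_law nu z * \prod_k g k (z k))); last first.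
  by move=> z _; rewrite big_split -!big_mkcond !big_pred1_eq.
rewrite product_law_prod /g (bigD1 i)//= (bigD1 j) 1?eq_sym//=.
rewrite [X in _ * (_ * X)]big1 ?mulr1; last first.
  move=> k /andP[/negPf ki /negPf kj]; rewrite -[RHS](nuP k).2.
  by apply: eq_bigr => y _; rewrite ki kj/= !mulr1.
rewrite !eqxx (eq_sym j) (negPf ij); congr (_ * _).
  by apply: eq_bigr => y _; rewrite mulr1.
by apply: eq_bigr => y _; rewrite mul1r.
Qed.

Lemma ising_weight_sum_gt0 : 0 < \sum_z ising_weight z.
Proof.
rewrite (bigD1 [ffun=> true])//= ltr_pwDl ?expR_gt0//.
by apply: sumr_ge0 => z _; exact: expR_ge0.
Qed.

Lemma mean_ln_ising (nu : factors R n) : are_pmfs nu ->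
  \sum_z product_law nu z * ln (ising z) =
  - (\sum_i h i * mean nu i)
  - \sum_(i < n) \sum_(j < n | (i < j)%N && e i j) J i j * mean nu i * mean nu j
  - ln (\sum_z ising_weight z).
Proof.
move=> nuP.
pose Z := \sum_z ising_weight z.
have lnE z : ln (ising z) = - (\sum_i h i * spin R (z i))
    - \sum_(i < n) \sum_(j < n | (i < j)%N && e i j)
        J i j * spin R (z i) * spin R (z j) - ln Z.
  rewrite ffunE lnM ?posrE ?expR_gt0 ?invr_gt0 ?ising_weight_sum_gt0//.
  by rewrite lnV ?posrE ?ising_weight_sum_gt0// /ising_weight expRK.
under eq_bigr do rewrite lnE !mulrBr mulrN.
rewrite !sumrB -mulr_suml product_law_sum1// mul1r sumrN; congr (- _ - _ - _).
  under eq_bigr do rewrite mulr_sumr.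
  rewrite exchange_big; apply: eq_bigr => i _ /=.
  rewrite -(product_law_spin i nuP) mulr_sumr.
  by apply: eq_bigr => z _; rewrite mulrCA.
under eq_bigr do rewrite mulr_sumr.
rewrite exchange_big; apply: eq_bigr => i _ /=.
under eq_bigr do rewrite mulr_sumr.
rewrite exchange_big; apply: eq_bigr => j /andP[ij _] /=.
have ji : i != j by rewrite -val_eqE neq_ltn ij.
rewrite -[RHS]mulrA -(product_law_spin2 nuP ji) mulr_sumr.
by apply: eq_bigr => z _; rewrite -mulrA mulrCA.
Qed.

(* The update is the coordinatewise variational update
   exp (E_{nu^{-i}}[log ising(x, X^{-i})]), normalised. *)
Lemma cavi_update_ising (i : 'I_n) (nu : factors R n) (x : bool) :
  symmetric e -> irreflexive e -> (forall j k, e j k -> J j k = J k j) ->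
  are_pmfs nu ->
  cavi_update i nu x =
  expR (mean_log_ising i nu x) / \sum_y expR (mean_log_ising i nu y).
Proof.
move=> esym eirr Jsym nuP.
have [c cE] : exists c, forall y,
    expR (mean_log_ising i nu y) = expR c * cavi_weight i nu y.
  exists (- (\sum_(j | j != i) h j * mean nu j)
    - \sum_(j < n | j != i) \sum_(k < n | [&& (j < k)%N, e j k & k != i])
        J j k * mean nu j * mean nu k - ln (\sum_z ising_weight z)) => y.
  rewrite -expRD; congr expR; rewrite /mean_log_ising.
  set nu' := set_factor _ _ _.
  have nu'P : are_pmfs nu'.
    move=> j; rewrite /nu' ffunE; case: ifP => // _; split.
      by move=> b; rewrite ffunE ler0n.
    by rewrite big_bool !ffunE; case: (y); rewrite /= ?addr0 ?add0r.
  have mi : mean nu' i = spin R y.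
    rewrite /mean big_bool ffunE eqxx !ffunE.
    by case: (y); rewrite /= !(mul0r, mul1r) ?addr0 ?add0r.
  have mj j : j != i -> mean nu' j = mean nu j.
    by move=> /negPf ji; rewrite /mean ffunE ji.
  rewrite mean_ln_ising//.
  rewrite (bigD1 i)//= mi (eq_bigr (fun j => h j * mean nu j)); last first.
    by move=> j ji; rewrite mj.
  rewrite [X in _ - X - ln _ = _](bigD1 i)//=.
  rewrite [X in _ - (_ + X) - ln _ = _](eq_bigr (fun j : 'I_n =>
     (if (j < i)%N && e j i then J i j * spin R y * mean nu j else 0) +
     \sum_(k < n | [&& (j < k)%N, e j k & k != i])
        J j k * mean nu j * mean nu k)); last first.
    move=> j ji; rewrite (mj _ ji) (bigID (pred1 i))/=; congr (_ + _).
      case: ifPn => [/andP[lji eji]|Nji].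
        rewrite (big_pred1 i) => [|k]; last first.
          by rewrite andbC /=; case: eqP => [->|] //; rewrite lji eji.
        by rewrite mi Jsym// mulrAC.
      rewrite big_pred0// => k.
      by rewrite andbC /=; case: eqP => [->|] //=; rewrite (negPf Nji).
    apply: eq_big => [k|k /andP[_ ki]]; first by rewrite andbA.
    by rewrite mj.
  rewrite big_split/=.
  rewrite [X in _ - (X + _) - ln _ = _](eq_bigr
    (fun j => J i j * spin R y * mean nu j)); last first.
    by move=> j /andP[ij _]; rewrite mi mj // -val_eqE neq_ltn ij orbT.
  have -> : \sum_(j | e i j) \sum_z nu j z * (J i j * spin R y * spin R z) =
      \sum_(j < n | (i < j)%N && e i j) J i j * spin R y * mean nu j +
      \sum_(j < n | j != i) (if (j < i)%N && e j i
        then J i j * spin R y * mean nu j else 0).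
    rewrite -big_mkcondr/= (bigID (fun j : 'I_n => (i < j)%N))/=; congr (_ + _).
      apply: eq_big => [j|j _]; first by rewrite andbC.
      by rewrite mulr_sumr; apply: eq_bigr => z _; rewrite mulrCA.
    apply: eq_big => [j|j _].
      rewrite -leqNgt leq_eqVlt (esym j i) -val_eqE/=.
      have [/val_inj ->|ji] := eqVneq (val j) (val i); first by rewrite eirr.
      by rewrite andbC.
    by rewrite mulr_sumr; apply: eq_bigr => z _; rewrite mulrCA.
  ring.
under eq_bigr do rewrite cE.
rewrite cE -mulr_sumr ffunE invfM mulrACA divff ?mul1r//.
by rewrite gt_eqF ?expR_gt0.
Qed.

End Ising.

Definition iid_uniform (R : realType) (n : nat) (d : measure_display)
    (Omega : measurableType d) (P : probability Omega R)
    (I : nat -> Omega -> 'I_n) : Prop :=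
  [/\ forall k (A : {set 'I_n}), measurable [set w | I k w \in A],
      forall k i, P [set w | I k w = i] = (n%:R^-1)%:E
    & forall (s : seq nat) (A : nat -> {set 'I_n}), uniq s ->
        P [set w | forall k, k \in s -> I k w \in A k] =
        (\prod_(k <- s) P [set w | I k w \in A k])%E].

(* Elementary conditional expectation E[X | Y] for a random element Y with
   finitely many values: on {Y = y} it is E[X 1_{Y = y}] / P(Y = y). *)
Definition cond_expectation (R : realType) (d : measure_display)
    (Omega : measurableType d) (P : probability Omega R) (V : Type)
    (X : Omega -> R) (Y : Omega -> V) (w : Omega) : R :=
  fine (\int[P]_(w' in [set w' | Y w' = Y w]) (X w')%:E) /
  fine (P [set w' | Y w' = Y w]).

(* Largest modulus of a complex eigenvalue. *)
Definition spectral_radius (R : realType) (n : nat) (A : 'M[R]_n) : R :=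
  sup [set r | exists2 z : R[i],
         eigenvalue (map_mx (real_complex R) A) z & r = Normc.normc z].

Definition mx_le (R : realType) (m n : nat) (A B : 'M[R]_(m, n)) : Prop :=
  forall i j, A i j <= B i j.

Definition tv_vector (R : realType) (n : nat) (nu nu' : factors R n) : 'cV[R]_n :=
  \col_i tv (nu i) (nu' i).

Definition influence (R : realType) (n : nat) (J : 'M[R]_n) : 'M[R]_n :=
  \matrix_(i, j) if i == j then 0 else `|J i j|.

Definition lower_part (R : realType) (n : nat) (A : 'M[R]_n) : 'M[R]_n :=
  \matrix_(i, j) if (j < i)%N then A i j else 0.

Definition upper_part (R : realType) (n : nat) (A : 'M[R]_n) : 'M[R]_n :=
  \matrix_(i, j) if (i < j)%N then A i j else 0.

Definition sequential_rate_mx (R : realType) (n : nat) (A : 'M[R]_n) : 'M[R]_n :=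
  invmx (1%:M - lower_part A) *m upper_part A.

Definition random_scan_rate_mx (R : realType) (n : nat) (A : 'M[R]_n) : 'M[R]_n :=
  n%:R^-1 *: A + ((n%:R - 1) / n%:R) *: 1%:M.

(* Main.v *)
(* With m_j the mean of the j-th factor, the update of coordinate i is a logistic
   function of -2 (h_i + \sum_j J_ij m_j); the logistic function is
   1/4-Lipschitz and the total variation distance on spins is |m - m'| / 2, so
   the distance of two updates is at most \sum_j R_ij T_j.  Every scheme thus
   satisfies T_(k+1) <= A T_k entrywise for its rate matrix A >= 0, and A^k is
   bounded by C r^k for each r above the spectral radius, by Cayley-Hamilton.
   The fixed point is the limit of the parallel iterates.  For the random scan,
   the iterate after k steps is a function of the k coordinates drawn, all n^k
   histories being equally likely. *)

Require Import Defs.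
From HB Require Import structures.
From mathcomp Require Import all_boot all_order all_algebra.
From mathcomp Require Import complex.
From mathcomp Require Import all_classical all_reals all_analysis.
From mathcomp Require Import measurable_realfun.
From mathcomp Require Import ring lra.

Set Implicit Arguments.
Unset Strict Implicit.
Unset Printing Implicit Defensive.

Import Order.TTheory GRing.Theory Num.Theory.
Import numFieldNormedType.Exports.

Local Open Scope classical_set_scope.
Local Open Scope ring_scope.

(** * Powers of a matrix and its spectral radius *)

(** The constant [D] satisfies [z * D + C <= r * D], so the bound [D * r ^+ k] is stable under the
    recurrence. *)
Lemma affine_recurrence_le (R : realFieldType) (u : nat -> R) (z r C : R) :
  0 <= z -> z < r -> 0 <= C ->
  (forall k, u k.+1 <= z * u k + C * r ^+ k) ->
  forall k, u k <= Num.max (u 0%N) (C / (r - z)) * r ^+ k.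
Proof.
move=> z0 zr C0 uS; set D := Num.max _ _.
have CD : C <= D * (r - z).
  by rewrite -ler_pdivrMr ?subr_gt0// /D le_max lexx orbT.
have r0 : 0 <= r by rewrite ltW// (le_lt_trans z0).
elim=> [|k IH]; first by rewrite expr0 mulr1 /D le_max lexx.
apply: le_trans (uS k) _; rewrite exprS mulrA.
apply: (@le_trans _ _ ((z * D + C) * r ^+ k)).
  by rewrite mulrDl lerD2r -mulrA ler_wpM2l.
by apply: ler_wpM2r; [exact: exprn_ge0 | lra].
Qed.

Lemma le0_geometric (R : realType) (x C r : R) : 0 <= r -> r < 1 ->
  (forall k, x <= C * r ^+ k) -> x <= 0.
Proof.
move=> r0 r1 xC.
have /(@cvg_geometric R C) rC : `|r| < 1 by rewrite ger0_norm.
rewrite -(cvg_lim _ rC)//; apply: limr_ge; first by apply/cvg_ex; exists 0.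
by near=> k; exact: xC.
Unshelve. all: by end_near.
Qed.

(** [C / (1 - r) * r ^+ k] is the tail of the geometric series bounding the remaining increments;
    the limit is a common point of nested intervals of this radius around [u k]. *)
Lemma geometric_increments_lim (R : realType) (u : nat -> R) (C r : R) :
  0 <= r -> r < 1 -> (forall k, `|u k.+1 - u k| <= C * r ^+ k) ->
  exists l, forall k, `|u k - l| <= C / (1 - r) * r ^+ k.
Proof.
move=> r0 r1 uC; set D := C / (1 - r).
have DC : C = D * (1 - r) by rewrite divfK// subr_eq0 gt_eqF.
have C0 : 0 <= C by have := uC 0%N; rewrite expr0 mulr1; exact: le_trans.
have D0 : 0 <= D by rewrite divr_ge0// subr_ge0 ltW.
(* [u k - D r^k] increases and [u k + D r^k] decreases. *)
pose lo k := u k - D * r ^+ k; pose hi k := u k + D * r ^+ k.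
have step k : lo k <= lo k.+1 /\ hi k.+1 <= hi k.
  have := uC k; rewrite ler_norml /lo /hi exprS DC => /andP[].
  by move=> ? ?; split; lra.
have lohi j k : lo j <= hi k.
  have lo_nd a b : (a <= b)%N -> lo a <= lo b.
    move=> /subnK <-; elim: (b - a)%N => [//|m IH].
    by rewrite addSn (le_trans IH)// (step _).1.
  have hi_ni a b : (a <= b)%N -> hi b <= hi a.
    move=> /subnK <-; elim: (b - a)%N => [//|m IH].
    by rewrite addSn (le_trans (step _).2).
  have lohik m : lo m <= hi m.
    by rewrite /lo /hi lerD2l ge0_cp// mulr_ge0// exprn_ge0.
  apply: le_trans (lo_nd _ _ (leq_maxl j k)) _.
  exact: le_trans (lohik _) (hi_ni _ _ (leq_maxr j k)).
exists (sup (range lo)) => k.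
have : lo k <= sup (range lo).
  by apply: ub_le_sup; [exists (hi 0%N) => _ [j _ <-] | exists k].
have : sup (range lo) <= hi k.
  by apply: ge_sup; [exists (lo 0%N), 0%N | move=> _ [j _ <-]].
by rewrite ler_norml /lo /hi => ? ?; apply/andP; split; lra.
Qed.

Section SpectralRadius.
Variable R : realType.
Implicit Types n : nat.

Lemma normc_real (x : R) : Normc.normc (real_complex R x) = `|x|.
Proof. by rewrite /= expr0n/= addr0 sqrtr_sqr. Qed.

Lemma normc_ge0 (z : R[i]) : 0 <= Normc.normc z.
Proof. by case: z => a b; exact: sqrtr_ge0. Qed.

(* [N_j = \prod_(i < j) (A - z_i)] with [z] the roots of the characteristic
   polynomial vanishes for [j = n] by Cayley-Hamilton, and
   [A^(k+1) N_j = z_j A^k N_j + A^k N_(j+1)]. *)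
Lemma char_poly_expmx_le n (A : 'M[R[i]]_n) (r : R) : 0 <= r ->
  (forall z, eigenvalue A z -> Normc.normc z < r) ->
  exists2 C : R, 0 <= C &
    forall k i j, Normc.normc ((A ^+ k) i j) <= C * r ^+ k.
Proof.
case: n A => [|n] A r0 Ar; first by exists 0 => // k [].
have [s sE] := closed_field_poly_normal (char_poly A).
rewrite (monicP (char_poly_monic A)) scale1r in sE.
have sr z : z \in s -> Normc.normc z < r.
  by move=> zs; apply: Ar; rewrite eigenvalue_root_char sE root_prod_XsubC.
have : horner_mx A (\prod_(z <- s) ('X - z%:P)) = 0.
  by rewrite -sE Cayley_Hamilton.
clear sE Ar; rewrite -[X in horner_mx A X](mulr1 _).
set p := 1.
(* The cofactor [q], initially 1, makes the induction work: each root taken off the product moves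
   its linear factor into [q]. *)
suff H (q : {poly R[i]}) : horner_mx A (\prod_(z <- s) ('X - z%:P) * q) = 0 ->
    exists2 C : R, 0 <= C & forall k i j,
      Normc.normc ((A ^+ k * horner_mx A q) i j) <= C * r ^+ k.
  move=> /H [C C0 HC]; exists C => // k i j.
  by have := HC k i j; rewrite rmorph1 mulr1.
elim: s sr q => [_ q|z s IH sr q].
  rewrite big_nil mul1r => ->; exists 0 => // k i j.
  by rewrite mulr0 mxE Normc.normc0 mul0r.
rewrite big_cons mulrAC [X in horner_mx A X]mulrC => Hq.
have sr' y : y \in s -> Normc.normc y < r.
  by move=> ys; apply: sr; rewrite inE ys orbT.
have [C C0 HC] := IH sr' _ Hq.
have zr : Normc.normc z < r by apply: sr; rewrite inE eqxx.
pose u k i j := Normc.normc ((A ^+ k * horner_mx A q) i j).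
have uS i j k : u k.+1 i j <= Normc.normc z * u k i j + C * r ^+ k.
  have AE : A ^+ k.+1 * horner_mx A q =
      z *: (A ^+ k * horner_mx A q) + A ^+ k * horner_mx A (('X - z%:P) * q).
    rewrite rmorphM/= rmorphB/= horner_mx_X horner_mx_C -!mulmxE.
    by rewrite mulmxBl mulmxBr mul_scalar_mx scalemxAr addrC subrK exprSr mulmxA.
  rewrite /u AE mxE; apply: le_trans (le_normcD _ _) _.
  by rewrite lerD ?HC// mxE Normc.normcM.
pose D := \sum_i \sum_j Num.max (u 0%N i j) (C / (r - Normc.normc z)).
have D0 i j : 0 <= Num.max (u 0%N i j) (C / (r - Normc.normc z)).
  by rewrite le_max normc_ge0.
exists D => [|k i j].
  by apply: sumr_ge0 => i _; apply: sumr_ge0.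
apply: (@le_trans _ _ (Num.max (u 0%N i j) (C / (r - Normc.normc z)) * r ^+ k)).
  exact: (@affine_recurrence_le _ (fun k => u k i j) _ _ _
    (normc_ge0 _) zr C0 (uS i j)).
apply: ler_wpM2r; first exact: exprn_ge0.
rewrite /D (bigD1 i)//= (bigD1 j)//= -addrA lerDl addr_ge0//.
  by apply: sumr_ge0.
by apply: sumr_ge0 => i' _; apply: sumr_ge0.
Qed.

(** The supremum is over a bounded set: eigenvalues are roots of the characteristic polynomial, and
    the sum of the moduli of its roots bounds each modulus. *)
Lemma eigenvalue_le_spectral_radius n (A : 'M[R]_n) z :
  eigenvalue (map_mx (real_complex R) A) z ->
  Normc.normc z <= spectral_radius A.
Proof.
move=> Az; apply: ub_le_sup; last by exists z.
have [s sE] := closed_field_poly_normal (char_poly (map_mx (real_complex R) A)).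
rewrite (monicP (char_poly_monic _)) scale1r in sE.
exists (\sum_(y <- s) Normc.normc y) => _ [y Ay ->].
have ys : y \in s by rewrite -root_prod_XsubC -sE -eigenvalue_root_char.
by rewrite (big_rem y)//= lerDl sumr_ge0// => x _; exact: normc_ge0.
Qed.

Lemma spectral_radius_ge0 n (A : 'M[R]_n) : 0 <= spectral_radius A.
Proof.
rewrite /spectral_radius; set E := [set _ | _].
(* [sup] of the empty set is 0, which covers size 0. *)
have [[x Ex]|/set0P/negP/negPn/eqP ->] := pselect (E !=set0); last by rewrite sup0.
case: (Ex) => z Az xE; apply: le_trans (eigenvalue_le_spectral_radius Az).
exact: normc_ge0.
Qed.

(** Strictness survives the supremum because the eigenvalues are finitely many: a maximum over the
    roots of the characteristic polynomial lies in between, with base value 0 below [r]. *)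
Lemma spectral_radius_lt n (A : 'M[R]_n) (r : R) : 0 < r ->
  (forall z, eigenvalue (map_mx (real_complex R) A) z -> Normc.normc z < r) ->
  spectral_radius A < r.
Proof.
move=> r0 Ar; rewrite /spectral_radius; set E := [set _ | _].
have [E0|/set0P/negP/negPn/eqP ->] := pselect (E !=set0); last by rewrite sup0.
have [s sE] := closed_field_poly_normal (char_poly (map_mx (real_complex R) A)).
rewrite (monicP (char_poly_monic _)) scale1r in sE.
have AsE z : eigenvalue (map_mx (real_complex R) A) z = (z \in s).
  by rewrite eigenvalue_root_char sE root_prod_XsubC.
apply: (@le_lt_trans _ _ (\big[Num.max/0]_(z <- s) Normc.normc z)).
  apply: ge_sup => // _ [z Az ->]; apply: le_bigmax_seq => //.
  by rewrite -AsE.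
by rewrite big_seq; apply: bigmax_lt => // z zs; apply: Ar; rewrite AsE.
Qed.

(** The embedding into the complex numbers commutes with powers and preserves moduli, so the complex
    bound applies to the real matrix. *)
Lemma expmx_le n (A : 'M[R]_n) (r : R) : spectral_radius A < r ->
  exists2 C : R, 0 <= C & forall k i j, `|(A ^+ k) i j| <= C * r ^+ k.
Proof.
move=> Ar; have r0 := le_lt_trans (spectral_radius_ge0 A) Ar.
have [|C C0 HC] := @char_poly_expmx_le n (map_mx (real_complex R) A) r (ltW r0).
  by move=> z /eigenvalue_le_spectral_radius/le_lt_trans; apply.
exists C => // k i j; rewrite -normc_real.
have -> : real_complex R ((A ^+ k) i j) = (map_mx (real_complex R) A ^+ k) i j.
  elim: k i j => [|k IH] i j; first by rewrite !expr0 !mxE rmorph_nat.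
  rewrite !exprS -!mulmxE !mxE rmorph_sum; apply: eq_bigr => l _.
  by rewrite [map_mx _ _ i l]mxE -IH -rmorphM.
exact: HC.
Qed.

End SpectralRadius.

(** * Entrywise inequalities for nonnegative matrices *)

Section NonnegativeMatrices.
Variable R : realType.
Implicit Types m n : nat.

Lemma spectral_gap n (A : 'M[R]_n) (s : R) : spectral_radius A < s ->
  exists2 r : R, 0 < r & spectral_radius A < r < s.
Proof.
move=> As; exists ((spectral_radius A + s) / 2); last by rewrite !midf_lt.
by have := spectral_radius_ge0 A; lra.
Qed.

Definition nonneg_mx m n (A : 'M[R]_(m, n)) := forall i j, 0 <= A i j.

Lemma nonneg_expmx n (A : 'M[R]_n) k : nonneg_mx A -> nonneg_mx (A ^+ k).
Proof.
move=> A0; elim: k => [|k IH] i j; first by rewrite expr0 mxE ler0n.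
by rewrite exprS -mulmxE mxE; apply: sumr_ge0 => l _; exact: mulr_ge0.
Qed.

Lemma mx_le_trans m n (A B C : 'M[R]_(m, n)) :
  mx_le A B -> mx_le B C -> mx_le A C.
Proof. by move=> AB BC i j; exact: le_trans (AB i j) (BC i j). Qed.

Lemma mx_le_mull m n p (A : 'M[R]_(m, n)) (B C : 'M[R]_(n, p)) :
  nonneg_mx A -> mx_le B C -> mx_le (A *m B) (A *m C).
Proof.
by move=> A0 BC i j; rewrite !mxE ler_sum// => k _; exact: ler_wpM2l.
Qed.

Lemma mx_le_mulr m n p (A : 'M[R]_(n, p)) (B C : 'M[R]_(m, n)) :
  nonneg_mx A -> mx_le B C -> mx_le (B *m A) (C *m A).
Proof.
by move=> A0 BC i j; rewrite !mxE ler_sum// => k _; exact: ler_wpM2r.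
Qed.

Lemma mx_le_iter n (A : 'M[R]_n) (v : nat -> 'cV[R]_n) : nonneg_mx A ->
  (forall k, mx_le (v k.+1) (A *m v k)) ->
  forall k, mx_le (v k) (A ^+ k *m v 0%N).
Proof.
move=> A0 vS; elim=> [|k IH]; first by rewrite expr0 mul1mx => i j.
apply: mx_le_trans (vS k) _; rewrite exprS -mulmxE -mulmxA.
exact: mx_le_mull.
Qed.

(** Iterating gives [v <= A^k v] for all [k], and [A^k] tends to 0 geometrically. *)
Lemma mulmx_le_le0 n (A : 'M[R]_n) (v : 'cV[R]_n) : nonneg_mx A ->
  spectral_radius A < 1 -> mx_le v (A *m v) -> mx_le v 0.
Proof.
move=> A0 /spectral_gap[r r0 /andP[Ar r1]] vA i j; rewrite mxE.
have [C C0 HC] := expmx_le Ar.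
apply: (@le0_geometric _ _ (\sum_l C * `|v l j|) r) => [||k]; [exact: ltW|by []|].
apply: le_trans (mx_le_iter (v := fun=> v) A0 (fun=> vA) k i j) _.
rewrite mxE mulr_suml ler_sum// => l _.
rewrite mulrAC (le_trans (ler_norm _))// normrM ler_wpM2r//.
Qed.

(** The same argument for rows, needed for left eigenvectors. *)
Lemma mulmxr_le_le0 n (A : 'M[R]_n) (v : 'rV[R]_n) : nonneg_mx A ->
  spectral_radius A < 1 -> mx_le v (v *m A) -> mx_le v 0.
Proof.
move=> A0 /spectral_gap[r r0 /andP[Ar r1]] vA i j; rewrite mxE.
have [C C0 HC] := expmx_le Ar.
have vAk k : mx_le v (v *m A ^+ k).
  elim: k => [|k IH]; first by rewrite expr0 mulmx1 => ? ?.
  apply: mx_le_trans vA _; rewrite exprSr -mulmxE mulmxA.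
  exact: mx_le_mulr.
apply: (@le0_geometric _ _ (\sum_l C * `|v i l|) r) => [||k]; [exact: ltW|by []|].
apply: le_trans (vAk k i j) _; rewrite mxE mulr_suml ler_sum// => l _.
by rewrite mulrAC (le_trans (ler_norm _))// normrM mulrC ler_wpM2r.
Qed.

(** [C] is chosen before [v], so the bound is uniform over initialisations; total variation vectors
    have entries at most 1. *)
Lemma mx_le_iter_geometric n (A : 'M[R]_n) (r : R) : nonneg_mx A ->
  spectral_radius A < r ->
  exists2 C : R, 0 <= C & forall v : nat -> 'cV[R]_n,
    mx_le (v 0%N) (const_mx 1) -> (forall k, mx_le (v k.+1) (A *m v k)) ->
    forall k, \sum_i v k i 0 <= C * r ^+ k.
Proof.
move=> A0 Ar; have [C C0 HC] := expmx_le Ar.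
exists (\sum_(i < n) \sum_(j < n) C) => [|v v1 vS k].
  by do 2! [apply: sumr_ge0 => ? _].
rewrite mulr_suml ler_sum// => i _; rewrite mulr_suml.
apply: le_trans (mx_le_iter A0 vS k i 0) _; rewrite mxE ler_sum// => l _.
apply: le_trans (ler_wpM2l (nonneg_expmx k A0 i l) (v1 l 0)) _.
by rewrite mxE mulr1 (le_trans (ler_norm _)).
Qed.

(** * The rate matrix of the sequential scheme *)

Section Sequential.
Variables (n : nat) (A : 'M[R]_n).
Hypotheses (A_ge0 : nonneg_mx A) (A_diag : forall i, A i i = 0).
Let L := lower_part A.
Let U := upper_part A.
Let S := sequential_rate_mx A.

Let unit1L : 1%:M - L \in unitmx.
Proof.
rewrite unitmxE det_trig; last first.
  apply/is_trig_mxP => i j ij; rewrite !mxE ltnNge (ltnW ij) subr0.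
  by rewrite -val_eqE /= ltn_eqF.
by rewrite big1 ?unitr1// => i _; rewrite !mxE ltnn eqxx subr0.
Qed.

(** Implicit form of the product with [S], which replaces the inverse in the comparison
    arguments. *)
Lemma sequential_rate_mxE (v : 'cV[R]_n) : S *m v = L *m (S *m v) + U *m v.
Proof.
apply/eqP; rewrite -subr_eq0 opprD addrA subr_eq0; apply/eqP.
rewrite -{1}(mul1mx (S *m v)) -mulmxBl.
by rewrite mulmxA /S /sequential_rate_mx mulmxA mulmxV// mul1mx.
Qed.

(** [L] is strictly lower triangular, so row [i] involves only smaller indices and strong induction
    on [i] applies. *)
Lemma le_lower_part_le0 (v : 'cV[R]_n) : mx_le v (L *m v) -> mx_le v 0.
Proof.
move=> vL i j; have [m] := ubnP i; elim: m i => // m IH i /ltnSE im.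
apply: le_trans (vL i j) _; rewrite !mxE; apply: sumr_le0 => l _; rewrite mxE.
case: ifPn => [li|_]; last by rewrite mul0r.
have := IH l (leq_trans li im); rewrite mxE; exact: mulr_ge0_le0.
Qed.

(** Subtracting the implicit form of [S v] leaves [w - S v <= L (w - S v)], which forces
    [w - S v <= 0]. *)
Lemma sequential_le (v w : 'cV[R]_n) :
  mx_le w (L *m w + U *m v) -> mx_le w (S *m v).
Proof.
move=> wv i j; rewrite -subr_le0.
suff /(_ i j) : mx_le (w - S *m v) 0 by rewrite !mxE.
apply: le_lower_part_le0 => a b.
have := wv a b; have /matrixP/(_ a b) := sequential_rate_mxE v.
rewrite mulmxBr; move: (S *m v) => x.
move: (L *m x) (L *m w) (U *m v) => Lx Lw Uv; rewrite !mxE; lra.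
Qed.

(** Column [j] of [S] is [x = S delta_j]; as [U delta_j >= 0], the implicit form gives
    [- x <= L (- x)], hence [- x <= 0]. *)
Lemma nonneg_sequential_rate_mx : nonneg_mx S.
Proof.
move=> i j; rewrite -oppr_le0.
suff /(_ i 0) : mx_le (- (S *m delta_mx j 0 : 'cV[R]_n)) 0.
  by rewrite -colE !mxE.
apply: le_lower_part_le0 => a b.
rewrite mulmxN [leRHS]mxE [leLHS]mxE lerN2 {2}sequential_rate_mxE [leRHS]mxE.
rewrite lerDl mxE; apply: sumr_ge0 => l _; rewrite !mxE.
by case: ifP => _; rewrite ?mul0r// mulr_ge0// ler0n.
Qed.

(* A left eigenvector [v] gives [u = v (1 - L)^-1] with [u (U + z L) = z u];
   if [1 <= |z|] then [|u| <= |u| A], which forces [u = 0]. *)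
Lemma spectral_radius_sequential :
  spectral_radius A < 1 -> spectral_radius S < 1.
Proof.
move=> A1; apply: spectral_radius_lt => // z /eigenvalueP[v vS v0].
rewrite ltNge; apply/negP => z1.
pose f := real_complex R.
pose u := v *m invmx (map_mx f (1%:M - L)).
have f1L : map_mx f (1%:M - L) \in unitmx by rewrite map_unitmx.
have uL : u *m map_mx f (1%:M - L) = v by rewrite mulmxKV.
have uz : u *m map_mx f U = z *: u *m map_mx f (1%:M - L).
  by rewrite -scalemxAl uL -vS /S /sequential_rate_mx map_mxM map_invmx mulmxA.
have {}uz : z *: u = u *m (map_mx f U + z *: map_mx f L).
  rewrite mulmxDr uz map_mxB map_mx1 mulmxBr mulmx1 -scalemxAr -scalemxAl.
  by rewrite subrK.
pose w : 'rV[R]_n := map_mx (@Normc.normc R) u.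
suff w0 : mx_le w 0.
  move/eqP: v0; apply; rewrite -uL; suff -> : u = 0 by rewrite mul0mx.
  apply/matrixP => i j; have := w0 i j; rewrite !mxE => uij.
  by apply: Normc.eq0_normc; apply/eqP; rewrite eq_le uij normc_ge0.
have z0 : 0 < Normc.normc z := lt_le_trans ltr01 z1.
(* It suffices that [|z| |u| <= |z| |u| A]; the triangle inequality in [z u = u (U + z L)] reduces
   this to the entries of [U + z L]. *)
apply: (@mulmxr_le_le0 _ A) => // i j; rewrite !mxE.
rewrite -(ler_pM2l z0) -Normc.normcM.
have /matrixP/(_ i j) := uz; rewrite !mxE => ->.
have nsum (F : 'I_n -> R[i]) :
    Normc.normc (\sum_l F l) <= \sum_l Normc.normc (F l).
  elim/big_ind2 : _ => [|x1 x2 y1 y2 h1 h2|//]; first by rewrite Normc.normc0.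
  by apply: le_trans (le_normcD _ _) _; exact: lerD.
apply: le_trans (nsum _) _; rewrite mulr_sumr ler_sum// => l _.
rewrite !mxE Normc.normcM mulrCA ler_wpM2l ?normc_ge0//.
(* Above the diagonal [A l j <= |z| A l j] as [1 <= |z|]; below it the entry is [z A l j]; on it
   both sides vanish. *)
have [lj|jl|/val_inj->] := ltngtP l j; rewrite /f.
- rewrite rmorph0 mulr0 addr0 normc_real ger0_norm//.
  by rewrite ler_peMl.
- rewrite rmorph0 add0r Normc.normcM normc_real ger0_norm//.
- by rewrite rmorph0 mulr0 addr0 Normc.normc0 A_diag mulr0.
Qed.

End Sequential.

(** * The rate matrix of the random scan *)

Lemma nonneg_random_scan_rate_mx n (A : 'M[R]_n) :
  nonneg_mx A -> nonneg_mx (random_scan_rate_mx A).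
Proof.
move=> A0 i j; rewrite !mxE addr_ge0// mulr_ge0 ?invr_ge0 ?ler0n//.
rewrite divr_ge0// subr_ge0; case: n i {A A0 j} => [[]//|m] _.
by rewrite ler1n.
Qed.

(** An eigenvalue [z] in size [n.+1] yields the eigenvalue [n.+1 * z - n] of [A], of modulus below
    1; hence [n.+1 * |z| < n.+1]. In size 0 there is no nonzero vector. *)
Lemma spectral_radius_random_scan n (A : 'M[R]_n) :
  spectral_radius A < 1 -> spectral_radius (random_scan_rate_mx A) < 1.
Proof.
case: n A => [|n] A A1.
  apply: spectral_radius_lt => // z /eigenvalueP[v _ /eqP].
  by case; apply/matrixP => i [].
apply: spectral_radius_lt => // z /eigenvalueP[v vA v0].
have n0 : (n.+1%:R : R[i]) != 0 by rewrite pnatr_eq0.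
have /eigenvalue_le_spectral_radius zA :
    eigenvalue (map_mx (real_complex R) A) (n.+1%:R * z - n%:R).
  apply/eigenvalueP; exists v => //.
  rewrite scalerBl -scalerA -vA /random_scan_rate_mx map_mxD !map_mxZ.
  rewrite mulmxDr -!scalemxAr map_mx1 mulmx1 scalerDr !scalerA.
  rewrite !(rmorphM, fmorphV, rmorphB, rmorph1, rmorph_nat)/=.
  rewrite mulfV// scale1r mulrCA mulfV// mulr1.
  by rewrite -[X in X - 1]natr1 !addrK.
have zE : real_complex R n.+1%:R * z = (n.+1%:R * z - n%:R) + real_complex R n%:R.
  by rewrite !rmorph_nat subrK.
have := le_normcD (n.+1%:R * z - n%:R) (real_complex R n%:R).
rewrite -zE Normc.normcM !normc_real !ger0_norm ?ler0n// => H.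
have {H} := le_lt_trans (le_trans H (lerD zA (lexx _))) (ltr_leD A1 (lexx _)).
rewrite addrC natr1 -[ltRHS]mulr1 ltr_pM2l ?ltr0n//.
Qed.

End NonnegativeMatrices.

(** * Total variation distance *)

(** Mean value theorem: the derivative has modulus [e^t / (1 + e^t)^2], at most 1/4 because
    [(1 - e^t)^2 >= 0]. *)
Lemma logistic_lipschitz (R : realType) (x y : R) :
  `|(1 + expR x)^-1 - (1 + expR y)^-1| <= 4^-1 * `|x - y|.
Proof.
wlog xy : x y / x <= y => [H|].
  have /orP[/H//|/H] := le_total x y.
  by rewrite distrC (distrC x).
pose f (t : R) := (1 + expR t)^-1.
have f0 (t : R) : 1 + expR t != 0 by rewrite gt_eqF// addr_gt0// expR_gt0.
have df (t : R) : is_derive t (1 : R) f (- (1 + expR t) ^- 2 *: expR t).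
  apply: is_deriveV; first exact: f0.
  have := is_deriveD (is_derive_cst (1 : R) t 1) (is_derive_expR t).
  by rewrite add0r.
have cf : {within `[x, y], continuous f}.
  apply: continuous_subspaceT => t.
  by apply/differentiable_continuous/derivable1_diffP; case: (df t).
have [c _] := MVT_segment xy (fun t _ => df t) cf.
rewrite distrC => ->; rewrite normrM distrC ler_wpM2r//.
rewrite normrM normrN ger0_norm ?invr_ge0 ?sqr_ge0// ger0_norm ?expR_ge0//.
rewrite mulrC ler_pdivrMr ?exprn_gt0 ?addr_gt0 ?expR_gt0//.
have := sqr_ge0 (1 - expR c); nra.
Qed.

Section TotalVariation.
Variable R : realType.

Lemma tv_ge0 (T : finType) (p q : {ffun T -> R}) : 0 <= tv p q.
Proof. by rewrite mulr_ge0 ?invr_ge0// sumr_ge0. Qed.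

Lemma tv_triangle (T : finType) (p q r : {ffun T -> R}) :
  tv p r <= tv p q + tv q r.
Proof.
rewrite /tv -mulrDr ler_wpM2l ?invr_ge0// -big_split ler_sum// => x _.
exact: ler_distD.
Qed.

Lemma tv_sym (T : finType) (p q : {ffun T -> R}) : tv p q = tv q p.
Proof. by rewrite /tv; congr (_ * _); apply: eq_bigr => x _; rewrite distrC. Qed.

Lemma tv_le0 (T : finType) (p q : {ffun T -> R}) : tv p q <= 0 -> p = q.
Proof.
rewrite /tv pmulr_rle0 ?invr_gt0// => pq; apply/ffunP => x; apply/eqP.
rewrite -subr_eq0 -normr_le0 (le_trans _ pq)// (bigD1 x)//= lerDl.
by rewrite sumr_ge0.
Qed.

(** With equal masses the differences at the two spins are opposite. *)
Lemma tv_bool (p q : {ffun bool -> R}) :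
  \sum_x p x = 1 -> \sum_x q x = 1 -> tv p q = `|p true - q true|.
Proof.
rewrite !big_bool/= => p1 q1; rewrite /tv big_bool/=.
have -> : p false - q false = - (p true - q true) by lra.
by rewrite normrN; lra.
Qed.

Lemma tv_le1 (T : finType) (p q : {ffun T -> R}) :
  is_pmf p -> is_pmf q -> tv p q <= 1.
Proof.
move=> [p0 p1] [q0 q1]; rewrite /tv -ler_pdivlMl ?invr_gt0// invrK mulr1.
apply: (@le_trans _ _ (\sum_x (p x + q x))); last by rewrite big_split/= p1 q1.
by rewrite ler_sum// => x _; rewrite (le_trans (ler_normB _ _))// !ger0_norm.
Qed.

(** Telescoping: factors of [a] are replaced by those of [b] one at a time, the other factors having
    product at most 1. *)
Lemma ler_dist_prod (I : Type) (s : seq I) (a b : I -> R) :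
  (forall i, 0 <= a i <= 1) -> (forall i, 0 <= b i <= 1) ->
  `|\prod_(i <- s) a i - \prod_(i <- s) b i| <= \sum_(i <- s) `|a i - b i|.
Proof.
move=> a01 b01; elim: s => [|i s IH]; first by rewrite !big_nil subrr normr0.
rewrite !big_cons.
have -> : a i * \prod_(j <- s) a j - b i * \prod_(j <- s) b j =
    (a i - b i) * \prod_(j <- s) a j +
    b i * (\prod_(j <- s) a j - \prod_(j <- s) b j) by ring.
rewrite (le_trans (ler_normD _ _))// !normrM lerD//.
  rewrite ler_piMr// ger0_norm ?prodr_ge0//; first by rewrite prodr_ile1.
  by move=> j _; case/andP: (a01 j).
have /andP[b0 b1] := b01 i; rewrite ger0_norm// (le_trans _ IH)//.
by rewrite ler_piMl.
Qed.

(** Each configuration contributes at most the sum of the factor distances. The constant is crude,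
    but a constant does not affect exponential rates. *)
Lemma tv_product_law n (nu nu' : factors R n) :
  are_pmfs nu -> are_pmfs nu' ->
  tv (product_law nu) (product_law nu') <=
    #|{: config n}|%:R * \sum_i tv (nu i) (nu' i).
Proof.
move=> nuP nu'P.
have pmf01 (p : {ffun bool -> R}) x : is_pmf p -> 0 <= p x <= 1.
  move=> [p0 <-]; rewrite p0 (bigD1 x)//= lerDl sumr_ge0//.
rewrite mulr_natl -sumr_const /tv mulr_sumr.
have tvE i x : `|nu i x - nu' i x| <= 2^-1 * \sum_y `|nu i y - nu' i y|.
  have := tv_bool (nuP i).2 (nu'P i).2; rewrite /tv => ->.
  case: x => //; have := (nuP i).2; have := (nu'P i).2; rewrite !big_bool/=.
  move=> h' h; have -> : nu i false - nu' i false = - (nu i true - nu' i true).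
    by lra.
  by rewrite normrN.
apply: ler_sum => z _; rewrite !ffunE.
apply: (@le_trans _ _ `|\prod_i nu i (z i) - \prod_i nu' i (z i)|).
  by rewrite ler_piMl// invf_le1// ler1n.
apply: le_trans (ler_dist_prod _ _ _) _ => [i|i|]; rewrite ?pmf01//.
by apply: ler_sum.
Qed.

End TotalVariation.

(** * Contraction of the updates and the fixed point *)

Section Cavi.
Variables (R : realType) (n : nat) (e : rel 'I_n) (h : 'I_n -> R) (J : 'M[R]_n).
Hypothesis e_irr : irreflexive e.
Implicit Types nu : factors R n.

Lemma cavi_weight_gt0 i nu x : 0 < cavi_weight e h J i nu x.
Proof. exact: expR_gt0. Qed.

Lemma cavi_update_pmf i nu : is_pmf (cavi_update e h J i nu).
Proof.
have Z0 : 0 < \sum_y cavi_weight e h J i nu y.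
  by rewrite big_bool addr_gt0// cavi_weight_gt0.
split=> [x|]; first by rewrite ffunE divr_ge0 ?ltW// cavi_weight_gt0.
under eq_bigr do rewrite ffunE.
by rewrite -mulr_suml divff// gt_eqF.
Qed.

(** With [a] the local field, the spin weights are [e^(-a)] and [e^a], so the update is logistic;
    [nu j true - nu j false] is the mean spin of factor [j]. *)
Lemma cavi_update_true i nu : cavi_update e h J i nu true =
  (1 + expR (2 * (h i + \sum_(j | e i j) J i j * (nu j true - nu j false))))^-1.
Proof.
set a := h i + _.
have wE x : cavi_weight e h J i nu x = expR (- (spin R x * a)).
  congr expR; rewrite /a mulrDr opprD (mulrC (h i)) mulr_sumr; congr (_ - _).
  by apply: eq_bigr => j _; rewrite big_bool/=; case: x; rewrite /spin; ring.
rewrite ffunE big_bool/= !wE /spin mul1r mulN1r opprK.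
have -> : 2 * a = a + a by ring.
rewrite expRD expRN; have := expR_gt0 a; move: (expR a) => y y0.
by field; rewrite !gt_eqF ?addr_gt0 ?mulr_gt0.
Qed.

(** Stated for factors of total mass 1, so that it applies to the limit in the existence proof
    before its nonnegativity is known. *)
Lemma tv_cavi_update i nu nu' :
  (forall j, \sum_x nu j x = 1) -> (forall j, \sum_x nu' j x = 1) ->
  tv (cavi_update e h J i nu) (cavi_update e h J i nu') <=
  \sum_j influence J i j * tv (nu j) (nu' j).
Proof.
move=> nu1 nu'1.
rewrite tv_bool; [|exact: (cavi_update_pmf i nu).2|exact: (cavi_update_pmf i nu').2].
rewrite !cavi_update_true (le_trans (logistic_lipschitz _ _))//.
rewrite -mulrBr opprD addrACA subrr add0r -sumrB.
have -> : \sum_(j | e i j) (J i j * (nu j true - nu j false) -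
                            J i j * (nu' j true - nu' j false)) =
    2 * \sum_(j | e i j) J i j * (nu j true - nu' j true).
  rewrite mulr_sumr; apply: eq_bigr => j _.
  have := nu1 j; have := nu'1 j; rewrite !big_bool/= => h1 h2.
  have -> : nu j false = 1 - nu j true by lra.
  have -> : nu' j false = 1 - nu' j true by lra.
  by ring.
rewrite mulrA normrM ger0_norm// mulrA.
(* The Lipschitz constant 1/4 cancels two factors 2: one in the argument of the logistic function,
   one from the mean having slope 2 in [nu j true]. *)
have -> : 4^-1 * (2 * 2) = 1 :> R by field.
rewrite mul1r (le_trans (ler_norm_sum _ _ _))// big_mkcond ler_sum// => j _.
rewrite mxE; case: ifP => [eij|_].
  by rewrite ifN ?normrM ?tv_bool//; apply: contraTneq eij => <-; rewrite e_irr.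
by rewrite mulr_ge0 ?tv_ge0//; case: ifP.
Qed.

Lemma nonneg_influence : nonneg_mx (influence J).
Proof. by move=> i j; rewrite mxE; case: ifP. Qed.

Lemma influence_diag i : influence J i i = 0.
Proof. by rewrite mxE eqxx. Qed.

Hypothesis rho_lt1 : spectral_radius (influence J) < 1.

(** The distance vector [T] of two fixed points satisfies [T <= influence J *m T], which forces
    [T <= 0]. *)
Lemma cavi_fixed_point_unique nu nu' : are_pmfs nu -> are_pmfs nu' ->
  cavi_fixed_point e h J nu -> cavi_fixed_point e h J nu' -> nu = nu'.
Proof.
move=> nuP nu'P nuF nu'F.
suff T0 : mx_le (tv_vector nu nu') 0.
  by apply/ffunP => i; apply: tv_le0; have := T0 i 0; rewrite !mxE.
apply: mulmx_le_le0 rho_lt1 _; first exact: nonneg_influence.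
move=> i j; rewrite !mxE [in leLHS]nuF [in leLHS]nu'F.
apply: le_trans (tv_cavi_update _ _ _) _ => [l|l|]; first exact: (nuP l).2.
  exact: (nu'P l).2.
by apply: ler_sum => l _; rewrite [tv_vector _ _ _ _]mxE.
Qed.

Lemma cavi_fixed_point_exists :
  exists nu, are_pmfs nu /\ cavi_fixed_point e h J nu.
Proof.
pose F nu : factors R n := [ffun i => cavi_update e h J i nu].
(* Starting from an image of [F] makes every iterate a family of probability laws. *)
pose nu k := iter k F (F [ffun=> [ffun=> 0]]).
have nuP k : are_pmfs (nu k).
  by case: k => [|k] i; rewrite ffunE; exact: cavi_update_pmf.
have nuSE k i : nu k.+1 i = cavi_update e h J i (nu k) by rewrite ffunE.
have [r r0 /andP[Jr r1]] := spectral_gap rho_lt1.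
have [C C0 HC] := mx_le_iter_geometric nonneg_influence Jr.
(* Distances of consecutive iterates obey the same contraction, hence decay geometrically. *)
have nuC k : \sum_i tv (nu k.+1 i) (nu k i) <= C * r ^+ k.
  rewrite (eq_bigr (fun i => tv_vector (nu k.+1) (nu k) i 0)) => [|i _]; last first.
    by rewrite mxE.
  apply: (HC (fun k => tv_vector (nu k.+1) (nu k))) => [i j|m i j].
    by rewrite !mxE tv_le1//; exact: nuP.
  rewrite !mxE.
  rewrite (nuSE m.+1) [in leLHS]nuSE.
  apply: le_trans (tv_cavi_update _ _ _) _ => [l|l|]; [exact: (nuP _ l).2..|].
  by apply: ler_sum => l _; rewrite [tv_vector _ _ _ _]mxE.
have nu_lim i : exists l, forall k, `|nu k i true - l| <= C / (1 - r) * r ^+ k.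
  apply: geometric_increments_lim => //; first exact: ltW.
  move=> k; apply: le_trans (nuC k).
  rewrite -tv_bool ?(nuP _ _).2//; [|exact: (nuP _ _).2..].
  by rewrite (bigD1 i)//= lerDl sumr_ge0// => j _; exact: tv_ge0.
have [l Hl] := choice nu_lim.
(* The value at [false] is set by complement, so mass 1 is immediate; nonnegativity comes at the
   end, from the fixed point equation. *)
pose mu : factors R n := [ffun i => [ffun x => if x then l i else 1 - l i]].
have mu1 i : \sum_x mu i x = 1 by rewrite big_bool !ffunE/=; lra.
have nu_mu k i : tv (nu k i) (mu i) <= C / (1 - r) * r ^+ k.
  by rewrite tv_bool ?(nuP _ _).2// !ffunE.
have muF : cavi_fixed_point e h J mu.
  move=> i; apply: tv_le0.
  (* Through [nu k.+1], the distance from [mu i] to its update is at most a constant times [r ^+ k]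
     for every [k], hence 0. *)
  apply: (@le0_geometric _ _ (C / (1 - r) * r +
      \sum_j influence J i j * (C / (1 - r))) r) => // [|k]; first exact: ltW.
  rewrite (le_trans (tv_triangle _ (nu k.+1 i) _))// mulrDl lerD//.
    by rewrite tv_sym -mulrA -exprS.
  rewrite nuSE (le_trans (tv_cavi_update _ _ _))// => [j|]; first exact: (nuP _ j).2.
  rewrite mulr_suml ler_sum// => j _; rewrite -mulrA ler_wpM2l ?nonneg_influence//.
exists mu; split=> // i; rewrite muF; exact: cavi_update_pmf.
Qed.

(** * Contraction of the deterministic schemes towards the fixed point *)

Variable mu_star : factors R n.
Hypothesis mu_starP : are_pmfs mu_star.
Hypothesis mu_starF : cavi_fixed_point e h J mu_star.

Lemma tv_cavi_update_star i nu : are_pmfs nu ->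
  tv (cavi_update e h J i nu) (mu_star i) <=
  \sum_j influence J i j * tv (nu j) (mu_star j).
Proof.
move=> nuP; rewrite [X in tv _ X]mu_starF.
by apply: tv_cavi_update => j; [exact: (nuP j).2 | exact: (mu_starP j).2].
Qed.

Lemma parallel_cavi_pmfs mu : are_pmfs (mu 0%N) -> parallel_cavi e h J mu ->
  forall k, are_pmfs (mu k).
Proof. by move=> mu0 muS [//|k] i; rewrite muS; exact: cavi_update_pmf. Qed.

Lemma sequential_cavi_pmfs mu : are_pmfs (mu 0%N) -> sequential_cavi e h J mu ->
  forall k, are_pmfs (mu k).
Proof. by move=> mu0 muS [//|k] i; rewrite muS; exact: cavi_update_pmf. Qed.

Lemma tv_parallel_cavi mu : are_pmfs (mu 0%N) -> parallel_cavi e h J mu ->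
  forall k, mx_le (tv_vector (mu k.+1) mu_star)
                  (influence J *m tv_vector (mu k) mu_star).
Proof.
move=> mu0 muS k i j; rewrite !mxE muS.
apply: le_trans (tv_cavi_update_star _ _) _; first exact: parallel_cavi_pmfs.
by apply: ler_sum => l _; rewrite [tv_vector _ _ _ _]mxE.
Qed.

(** The updated factors [j < i] contribute [L T_(k+1)] and the old ones [j > i] contribute [U T_k],
    so the bound is implicit in [T_(k+1)]; [sequential_le] solves it. *)
Lemma tv_sequential_cavi mu : are_pmfs (mu 0%N) -> sequential_cavi e h J mu ->
  forall k, mx_le (tv_vector (mu k.+1) mu_star)
                  (sequential_rate_mx (influence J) *m tv_vector (mu k) mu_star).
Proof.
move=> mu0 muS k; have muP := sequential_cavi_pmfs mu0 muS.
apply: sequential_le => [|i j]; first exact: nonneg_influence.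
rewrite !mxE muS; apply: le_trans (tv_cavi_update_star _ _) _ => [l|].
  by rewrite ffunE; case: ifP => _; exact: muP.
rewrite -big_split ler_sum//= => l _; rewrite ffunE.
rewrite [lower_part _ _ _]mxE [upper_part _ _ _]mxE 2![tv_vector _ _ _ _]mxE.
case: ltngtP => [||/val_inj->]; rewrite ?mul0r ?addr0 ?add0r//.
by rewrite influence_diag mul0r.
Qed.

Lemma tv_product_law_geometric (A : 'M[R]_n) (r : R) :
  nonneg_mx A -> spectral_radius A < r ->
  exists C, forall mu : nat -> factors R n, (forall k, are_pmfs (mu k)) ->
    (forall k, mx_le (tv_vector (mu k.+1) mu_star)
                     (A *m tv_vector (mu k) mu_star)) ->
    forall k : nat, tv (product_law (mu k)) (product_law mu_star) <= C * r ^+ k.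
Proof.
move=> A0 Ar; have [C C0 HC] := mx_le_iter_geometric A0 Ar.
exists (#|{: config n}|%:R * C) => mu muP muS k.
rewrite (le_trans (tv_product_law _ _))// -mulrA ler_wpM2l//.
rewrite (eq_bigr (fun i => tv_vector (mu k) mu_star i 0)) => [|i _]; last by rewrite mxE.
apply: (HC (fun k => tv_vector (mu k) mu_star)) => // i j.
by rewrite !mxE tv_le1//; exact: muP.
Qed.

End Cavi.

(** * Histories of i.i.d. uniform coordinates *)

(** Splits a sum over histories by the most recent draw, stored at the head. *)
Lemma big_cons_tuple (R : Type) (idx : R) (op : Monoid.com_law idx) (T : finType)
    (k : nat) (Q : pred (k.+1.-tuple T)) (F : k.+1.-tuple T -> R) :
  \big[op/idx]_(s | Q s) F s =
  \big[op/idx]_(i : T) \big[op/idx]_(t : k.-tuple T | Q (cons_tuple i t))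
    F (cons_tuple i t).
Proof.
rewrite pair_big_dep/= (reindex (fun p : T * k.-tuple T => cons_tuple p.1 p.2))//=.
exists (fun s => (thead s, [tuple of behead s])) => [[i t] _|s _] /=.
  by congr (_, _); apply: val_inj.
by rewrite [RHS]tuple_eta.
Qed.

Section History.
Variables (R : realType) (n : nat) (d : measure_display)
  (Omega : measurableType d) (P : probability Omega R) (I : nat -> Omega -> 'I_n).

(** The latest draw comes first, so that [foldr] applies the updates in chronological order. *)
Fixpoint history (k : nat) (w : Omega) : k.-tuple 'I_n :=
  if k is k'.+1 then cons_tuple (I k' w) (history k' w) else [tuple].

Hypothesis I_iid : iid_uniform P I.

(** Writes the event as a cylinder over singletons, the form to which the independence of the draws
    applies. *)
Lemma history_eq_cylinder k (s : k.-tuple 'I_n) :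
  exists2 A : nat -> {set 'I_n}, forall j, (j < k)%N -> exists i, A j = [set i]%SET &
    [set w | history k w = s] =
    [set w | forall j, j \in iota 0 k -> I j w \in A j].
Proof.
elim: k s => [s|k IH s].
  exists (fun=> finset.set0) => //; rewrite tuple0 eqEsubset.
  by split=> w //= _; rewrite tuple0.
have [A A1 AE] := IH [tuple of behead s].
exists (fun j => if j == k then [set thead s]%SET else A j) => [j|].
  by rewrite ltnS leq_eqVlt; case: eqP => [_ _|_ /=]; [exists (thead s)|exact: A1].
have {}AE w : (history k w = [tuple of behead s]) <->
    (forall j, j \in iota 0 k -> I j w \in A j).
  by have /seteqP[h1 h2] := AE; split=> [/h1|/h2].
apply/seteqP; split=> w.
  rewrite /mkset (tuple_eta s) => /(congr1 val)[Ik hk] j.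
  rewrite mem_iota add0n ltnS => jk.
  have [->|kj] := eqVneq j k; first by rewrite inE Ik theadE.
  have /AE : history k w = [tuple of behead s] by apply: val_inj.
  by apply; rewrite mem_iota add0n ltn_neqAle kj.
move=> H; have {}H j : (j < k.+1)%N ->
    I j w \in (if j == k then [set thead s]%SET else A j).
  by move=> jk; apply: H; rewrite mem_iota.
rewrite /mkset [RHS]tuple_eta; apply: val_inj => /=; congr (_ :: _).
  by have := H k (ltnSn k); rewrite eqxx inE => /eqP.
suff -> : history k w = [tuple of behead s] by [].
apply/AE => j; rewrite mem_iota add0n => jk.
by have := H j (ltnW jk); rewrite ltn_eqF.
Qed.

Lemma measurable_history_eq k (s : k.-tuple 'I_n) :
  measurable [set w | history k w = s].
Proof.
have [I_meas _ _] := I_iid; have [A _ ->] := history_eq_cylinder s.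
rewrite (_ : [set w | _] = \bigcap_(j in [set` iota 0 k]) [set w | I j w \in A j]).
  by apply: bigcap_measurableType => j _; exact: I_meas.
by apply/seteqP; split.
Qed.

Lemma measurable_history k (S : {set k.-tuple 'I_n}) :
  measurable [set w | history k w \in S].
Proof.
rewrite (_ : [set w | _] = \bigcup_(s in [set` S]) [set w | history k w = s]).
  by apply: fin_bigcup_measurable => // s _; exact: measurable_history_eq.
by apply/seteqP; split=> [w wS|w [s sS /= ->]//]; exists (history k w).
Qed.

Lemma probability_history_eq k (s : k.-tuple 'I_n) :
  P [set w | history k w = s] = ((n%:R ^+ k)^-1)%:E.
Proof.
have [_ I_unif I_indep] := I_iid; have [A A1 ->] := history_eq_cylinder s.
rewrite I_indep ?iota_uniq// big_seq (eq_bigr (fun=> (n%:R^-1)%:E)) => [|j].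
  rewrite -big_seq prodEFin -[k in iota 0 k]subn0 prodr_const_nat subn0.
  by rewrite exprVn.
rewrite mem_iota add0n => /= /A1[i ->]; rewrite -(I_unif j i); congr (P _).
by apply/seteqP; split=> w /=; rewrite inE => /eqP.
Qed.

(** The integrand is a finite combination of indicators of the events [history k w = s], each of
    probability [n^(-k)]; nonnegativity lets the sum leave the integral. *)
Lemma integral_history k (S : {set k.-tuple 'I_n}) (f : k.-tuple 'I_n -> R) :
  (forall s, 0 <= f s) ->
  (\int[P]_(w in [set w | history k w \in S]) (f (history k w))%:E =
   ((\sum_(s in S) f s) / n%:R ^+ k)%:E)%E.
Proof.
move=> f0; set D := [set w | _].
have mD : measurable D by exact: measurable_history.
pose B (s : k.-tuple 'I_n) := [set w | history k w = s].
rewrite (eq_integral (fun w => \sum_s (f s)%:E * (\1_(B s) w)%:E)%E); last first.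
  move=> w _; rewrite (bigD1 (history k w))//= indicE mem_set// mule1.
  rewrite big1 ?adde0// => s /eqP sw; rewrite indicE memNset ?mule0// /B/=.
  by move=> /esym.
have mB s : measurable_fun D (EFin \o (\1_(B s) : Omega -> R)).
  apply/measurable_EFinP; apply: measurable_indic; exact: measurable_history_eq.
rewrite ge0_integral_sum//; last 2 first.
- by move=> s; apply: measurable_funeM; exact: mB.
- by move=> s w _; rewrite mule_ge0// lee_fin.
rewrite mulr_suml -sumEFin [RHS]big_mkcond/=; apply: eq_bigr => s _.
rewrite ge0_integralZl_EFin//; [|exact: mB].
rewrite integral_indic//; last exact: measurable_history_eq.
case: ifPn => sS.
  rewrite setIidl; last by rewrite /B /D => w /= ->.
  by rewrite EFinM; congr (_ * _)%E; exact: probability_history_eq.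
rewrite (_ : B s `&` D = set0) ?measure0 ?mule0//.
by apply/seteqP; split=> // w []; rewrite /B /D/= => ->; move/negP: sS.
Qed.

Lemma probability_history k (S : {set k.-tuple 'I_n}) :
  P [set w | history k w \in S] = (#|S|%:R / n%:R ^+ k)%:E.
Proof.
rewrite -sumr_const -(integral_history S (fun=> ler01)).
by rewrite integral_cst ?mul1e//; exact: measurable_history.
Qed.

End History.

(** * Random scan *)

Section RandomScan.
Variables (R : realType) (n : nat) (e : rel 'I_n) (h : 'I_n -> R) (J : 'M[R]_n).
Hypothesis e_irr : irreflexive e.
Variable mu_star : factors R n.
Hypothesis mu_starP : are_pmfs mu_star.
Hypothesis mu_starF : cavi_fixed_point e h J mu_star.

Definition scan_step (i : 'I_n) (nu : factors R n) : factors R n :=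
  set_factor i (cavi_update e h J i nu) nu.

Lemma scan_step_pmfs i nu : are_pmfs nu -> are_pmfs (scan_step i nu).
Proof.
by move=> nuP j; rewrite ffunE; case: ifP => // _; exact: cavi_update_pmf.
Qed.

Lemma foldr_scan_step_pmfs nu s : are_pmfs nu -> are_pmfs (foldr scan_step nu s).
Proof. by move=> nuP; elim: s => //= i s; exact: scan_step_pmfs. Qed.

(** Of the [n] possible draws exactly one updates coordinate [i]; the other [n - 1] leave factor [i]
    unchanged. *)
Lemma mean_tv_scan_step nu i : are_pmfs nu ->
  n%:R^-1 * \sum_(l < n) tv (scan_step l nu i) (mu_star i) <=
  (random_scan_rate_mx (influence J) *m tv_vector nu mu_star) i 0.
Proof.
move=> nuP.
have -> : \sum_(l < n) tv (scan_step l nu i) (mu_star i) =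
    tv (cavi_update e h J i nu) (mu_star i) + (n%:R - 1) * tv (nu i) (mu_star i).
  rewrite (bigD1 i)//= ffunE eqxx; congr (_ + _).
  rewrite (eq_bigr (fun=> tv (nu i) (mu_star i))) => [|l li]; last first.
    by rewrite ffunE eq_sym (negPf li).
  rewrite sumr_const cardC1 card_ord -[LHS]mulr_natl -subn1 natrB//.
  exact: leq_ltn_trans (ltn_ord i).
rewrite /random_scan_rate_mx mulmxDl -!scalemxAl mul1mx.
rewrite mxE [X in _ <= X + _]mxE [X in _ <= _ + X]mxE mulrDr.
rewrite [tv_vector _ _ i 0]mxE [_ * (_ * tv _ _)]mulrCA [_ * (_ * tv _ _)]mulrA lerD2r.
rewrite ler_wpM2l ?invr_ge0// mxE.
apply: le_trans (tv_cavi_update_star e_irr mu_starP mu_starF i nuP) _.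
by apply: ler_sum => l _; rewrite [tv_vector _ _ _ _]mxE.
Qed.

(* Averages over the [n^k] equally likely histories of length [k]. *)
Lemma mean_tv_scan_geometric (r : R) :
  spectral_radius (random_scan_rate_mx (influence J)) < r ->
  exists2 C : R, 0 <= C & forall mu0, are_pmfs mu0 -> forall k,
    \sum_i (\sum_(s : k.-tuple 'I_n) tv (foldr scan_step mu0 s i) (mu_star i))
             / n%:R ^+ k <= C * r ^+ k.
Proof.
move=> Ar; have A0 := nonneg_random_scan_rate_mx (nonneg_influence J).
have [C C0 HC] := mx_le_iter_geometric A0 Ar; exists C => // mu0 mu0P k.
(* [v k] is the mean of [T_k] over all histories. *)
pose v k : 'cV[R]_n :=
  (n%:R ^+ k)^-1 *: \sum_(s : k.-tuple 'I_n) tv_vector (foldr scan_step mu0 s) mu_star.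
have vE m i : v m i 0 =
    (\sum_(s : m.-tuple 'I_n) tv (foldr scan_step mu0 s i) (mu_star i)) / n%:R ^+ m.
  rewrite mxE summxE mulrC; congr (_ / _).
  by apply: eq_bigr => s _; rewrite mxE.
under eq_bigr do rewrite -vE.
apply: HC => [i j|m i j]; rewrite ord1.
  rewrite vE expr0 divr1 mxE (big_pred1 [tuple]) => [|s]; last first.
    by apply/esym/eqP; exact: tuple0.
  by rewrite tv_le1//; exact: foldr_scan_step_pmfs.
(* The latest draw is averaged first, for a fixed earlier history, where the one-step bound
   applies. *)
rewrite vE big_cons_tuple exchange_big/= mulrC exprS invfM -mulrA mulrCA.
rewrite -scalemxAr mxE ler_wpM2l ?invr_ge0 ?exprn_ge0//.
rewrite mulmx_sumr summxE mulr_sumr ler_sum// => s _.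
by apply: mean_tv_scan_step; exact: foldr_scan_step_pmfs.
Qed.

Section Process.
Variables (d : measure_display) (Omega : measurableType d)
  (P : probability Omega R) (I : nat -> Omega -> 'I_n)
  (mu0 : factors R n) (mu : nat -> Omega -> factors R n).
Hypotheses (I_iid : iid_uniform P I) (mu0P : are_pmfs mu0)
  (mu_scan : random_scan_cavi e h J I mu0 mu).

Lemma random_scan_history k w : mu k w = foldr scan_step mu0 (history I k w).
Proof.
have [mu00 muS] := mu_scan; elim: k => [|k IH]; first exact: mu00.
by apply/ffunP => i; rewrite muS /= -IH ffunE; case: eqP => [->|].
Qed.

(** Since [mu k] is a function of the history, conditioning on its value restricts to a set [S] of
    equally likely histories; the next draw stays uniform, so the ratio is the one-step mean. *)
Lemma cond_expectation_random_scan k w :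
  mx_le (\col_i cond_expectation P
           (fun w' => tv (mu k.+1 w' i) (mu_star i)) (mu k) w)
        (random_scan_rate_mx (influence J) *m tv_vector (mu k w) mu_star).
Proof.
move=> i j; rewrite ord1 mxE.
have n0 : (n%:R : R) != 0 by rewrite pnatr_eq0 -lt0n (leq_ltn_trans _ (ltn_ord i)).
pose S := [set s : k.-tuple 'I_n | foldr scan_step mu0 s == mu k w]%SET.
(* The same event one step later: the newest draw, at the head, is unrestricted. *)
pose S' := [set s : k.+1.-tuple 'I_n |
  foldr scan_step mu0 (behead s) == mu k w]%SET.
have SE : [set w' | mu k w' = mu k w] = [set w' | history I k w' \in S].
  by apply/seteqP; split=> w'; rewrite /mkset inE -random_scan_history => /eqP.
have S'E : [set w' | history I k w' \in S] = [set w' | history I k.+1 w' \in S'].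
  by apply/seteqP; split=> w'; rewrite /mkset !inE.
(* The history of [w] itself lies in [S], so the conditioning event has positive probability. *)
have S0 : (#|S|%:R : R) != 0.
  rewrite pnatr_eq0 -lt0n; apply/card_gt0P; exists (history I k w).
  by rewrite inE -random_scan_history.
rewrite /cond_expectation SE probability_history//= S'E.
under eq_integral do rewrite random_scan_history.
rewrite (integral_history I_iid _
  (f := fun s => tv (foldr scan_step mu0 s i) (mu_star i))) => [|s]; last first.
  exact: tv_ge0.
have -> : \sum_(s in S') tv (foldr scan_step mu0 s i) (mu_star i) =
    #|S|%:R * \sum_(l < n) tv (scan_step l (mu k w) i) (mu_star i).
  rewrite big_cons_tuple mulr_sumr; apply: eq_bigr => l _.
  rewrite mulr_natl -sumr_const; apply: eq_big => s; first by rewrite !inE.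
  by rewrite inE /= => /eqP ->.
set c := \sum_(l < n) _.
have -> : fine ((#|S|%:R * c / n%:R ^+ k.+1)%:E) / (#|S|%:R / n%:R ^+ k) = n%:R^-1 * c.
  by rewrite /= exprS; field; rewrite S0 n0 expf_neq0.
apply: mean_tv_scan_step; rewrite random_scan_history.
exact: foldr_scan_step_pmfs.
Qed.

Lemma expectation_random_scan k :
  ('E_P [fun w => tv (product_law (mu k w)) (product_law mu_star)] <=
   (#|{: config n}|%:R *
    \sum_i (\sum_(s : k.-tuple 'I_n) tv (foldr scan_step mu0 s i) (mu_star i))
             / n%:R ^+ k)%:E)%E.
Proof.
rewrite unlock.
(* The whole space is recast as a history event, so that the integral becomes a sum over
   histories. *)
rewrite (_ : setT = [set w | history I k w \in [set: k.-tuple 'I_n]%SET]); last first.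
  by apply/seteqP; split=> w _ //=; rewrite inE.
under eq_integral do rewrite random_scan_history.
rewrite (integral_history I_iid _
  (f := fun s => tv (product_law (foldr scan_step mu0 s)) (product_law mu_star)));
  last by move=> s; exact: tv_ge0.
rewrite lee_fin -mulr_suml mulrA ler_wpM2r ?invr_ge0 ?exprn_ge0//.
rewrite exchange_big mulr_sumr big_mkcond ler_sum//= => s _; rewrite inE.
by apply: tv_product_law => //; exact: foldr_scan_step_pmfs.
Qed.

End Process.
End RandomScan.

Theorem proposition17 (R : realType) (n : nat) (e : rel 'I_n)
    (h : 'I_n -> R) (J : 'M[R]_n)
    (e_sym : symmetric e) (e_irr : irreflexive e)
    (J_sym : forall i j, e i j -> J i j = J j i)
    (J_nonedge : forall i j, ~~ e i j -> J i j = 0)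
    (rho_lt1 : spectral_radius (influence J) < 1) :
  let par_mx := influence J in
  let seq_mx := sequential_rate_mx (influence J) in
  let rnd_mx := random_scan_rate_mx (influence J) in
  exists mu_star : factors R n,
    [/\ (are_pmfs mu_star /\ cavi_fixed_point e h J mu_star) /\
        (forall nu, are_pmfs nu -> cavi_fixed_point e h J nu -> nu = mu_star),
        [/\ spectral_radius seq_mx < 1,
            forall mu : nat -> factors R n,
              are_pmfs (mu 0%N) -> sequential_cavi e h J mu ->
              forall k, mx_le (tv_vector (mu k.+1) mu_star)
                              (seq_mx *m tv_vector (mu k) mu_star)
          & forall r, spectral_radius seq_mx < r ->
              exists C : R, forall mu : nat -> factors R n,
                are_pmfs (mu 0%N) -> sequential_cavi e h J mu ->
                forall k : nat, tv (product_law (mu k)) (product_law mu_star)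
                          <= C * r ^+ k],
        [/\ spectral_radius rnd_mx < 1,
            forall (d : measure_display) (Omega : measurableType d)
                (P : probability Omega R) (I : nat -> Omega -> 'I_n) mu0 mu,
              iid_uniform P I -> are_pmfs mu0 ->
              random_scan_cavi e h J I mu0 mu ->
              forall k, {ae P, forall w,
                mx_le (\col_i cond_expectation P
                         (fun w' => tv (mu k.+1 w' i) (mu_star i)) (mu k) w)
                      (rnd_mx *m tv_vector (mu k w) mu_star)}
          & forall r, spectral_radius rnd_mx < r ->
              exists C : R, forall (d : measure_display)
                  (Omega : measurableType d) (P : probability Omega R)
                  (I : nat -> Omega -> 'I_n) mu0 mu,
                iid_uniform P I -> are_pmfs mu0 ->
                random_scan_cavi e h J I mu0 mu ->
                forall k : nat, ('E_P [fun w => tv (product_law (mu k w))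
                                             (product_law mu_star)]
                           <= (C * r ^+ k)%:E)%E]
      & [/\ spectral_radius par_mx < 1,
            forall mu : nat -> factors R n,
              are_pmfs (mu 0%N) -> parallel_cavi e h J mu ->
              forall k, mx_le (tv_vector (mu k.+1) mu_star)
                              (par_mx *m tv_vector (mu k) mu_star)
          & forall r, spectral_radius par_mx < r ->
              exists C : R, forall mu : nat -> factors R n,
                are_pmfs (mu 0%N) -> parallel_cavi e h J mu ->
                forall k : nat, tv (product_law (mu k)) (product_law mu_star)
                          <= C * r ^+ k]].
Proof.
move=> par_mx seq_mx rnd_mx.
have par0 : nonneg_mx par_mx := nonneg_influence J.
have [mu_star [starP starF]] := cavi_fixed_point_exists h e_irr rho_lt1.
exists mu_star; split.
- split=> // nu nuP nuF; exact: (cavi_fixed_point_unique e_irr rho_lt1 nuP starP nuF).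
- split; first exact: (spectral_radius_sequential par0 (influence_diag J)).
    exact: (tv_sequential_cavi e_irr starP starF).
  move=> r rS; have seq0 := nonneg_sequential_rate_mx par0.
  have [C HC] := tv_product_law_geometric starP seq0 rS.
  exists C => mu mu0 muS; apply: HC; first exact: (sequential_cavi_pmfs mu0 muS).
  exact: (tv_sequential_cavi e_irr starP starF mu0 muS).
- split; first exact: spectral_radius_random_scan.
    (* The bound holds at every outcome, hence almost surely. *)
    move=> d Omega P I mu0 mu I_iid mu0P mu_scan k; apply: aeW => w.
    exact: (cond_expectation_random_scan e_irr starP starF I_iid mu0P mu_scan).
  move=> r rR.
  have [C C0 HC] := mean_tv_scan_geometric e_irr starP starF rR.
  exists (#|{: config n}|%:R * C) => d Omega P I mu0 mu I_iid mu0P mu_scan k.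
  apply: le_trans (expectation_random_scan starP I_iid mu0P mu_scan k) _.
  by rewrite lee_fin -mulrA ler_wpM2l// HC.
- split=> //; first exact: (tv_parallel_cavi e_irr starP starF).
  move=> r rP; have [C HC] := tv_product_law_geometric starP par0 rP.
  exists C => mu mu0 muS; apply: HC; first exact: (parallel_cavi_pmfs mu0 muS).
  exact: (tv_parallel_cavi e_irr starP starF mu0 muS).
Qed.
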